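(* Let $X$ and $Y$ be finite simple graphs and let $k$ be a non-negative integer. Then \[ \gamma (X\square Y\square P_n)\geq \frac{3}{4}\gamma(P_n)\gamma(X)\gamma(Y)\quad \text{if } n=3k \text{ with } k\geq 1, \] \[ \gamma (X\square Y\square P_n)\geq \frac{3k+1}{4k+2}\gamma(P_n)\gamma(X)\gamma(Y)\quad \text{if } n=3k+1, \] \[ \gamma (X\square Y\square P_n)\geq \frac{3k+2}{4k+3}\gamma(P_n)\gamma(X)\gamma(Y)\quad \text{if } n=3k+2. \]
   Context: $\gamma(G)$ denotes the domination number of a graph $G$ (the minimum size of a set $S\subseteq V(G)$ such that every vertex of $G$ is in $S$ or adjacent to a vertex of $S$). $X\square Y$ denotes the Cartesian product of graphs: vertex set $V(X)\times V(Y)$, with $(x_1,y_1)$ adjacent to $(x_2,y_2)$ iff either $x_1=x_2$ and $y_1y_2\in E(Y)$, or $y_1=y_2$ and $x_1x_2\in E(X)$. $P_n$ is the path graph on $n$ vertices. *)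

(* Defs.v *)
(* MathComp *)
From HB Require Import structures.
From mathcomp Require Import all_boot all_order all_algebra.

Set Implicit Arguments.
Unset Strict Implicit.
Unset Printing Implicit Defensive.

Record sgraph := SGraph {
  vertex :> finType;
  adj : rel vertex;
  adj_sym : symmetric adj;
  adj_irr : irreflexive adj
}.

Definition dominating (G : sgraph) (S : {set G}) : bool :=
  [forall v : G, (v \in S) || [exists u in S, adj v u]].

(* [set: G] is dominating, so this is the minimum over dominating sets. *)
Definition domination_number (G : sgraph) : nat :=
  #|[arg min_(S < [set: G] | dominating S) #|S| ]|.

Lemma dominatingT (G : sgraph) : dominating [set: G].
Proof. by apply/forallP => v; rewrite in_setT. Qed.

Lemma domination_numberP (G : sgraph) :
  (exists2 S : {set G}, dominating S & #|S| = domination_number G) /\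
  (forall S : {set G}, dominating S -> domination_number G <= #|S|).
Proof.
rewrite /domination_number; case: arg_minnP => [|S domS minS].
  exact: dominatingT.
by split=> //; exists S.
Qed.

Section CartesianProduct.
Variables X Y : sgraph.

Definition box_adj : rel (X * Y) := fun p q =>
  ((p.1 == q.1) && adj p.2 q.2) || ((p.2 == q.2) && adj p.1 q.1).

Lemma box_adj_sym : symmetric box_adj.
Proof.
move=> p q; rewrite /box_adj (eq_sym p.1) (eq_sym p.2).
by rewrite (adj_sym p.1) (adj_sym p.2).
Qed.

Lemma box_adj_irr : irreflexive box_adj.
Proof. by move=> p; rewrite /box_adj !adj_irr !andbF. Qed.

Definition box : sgraph := SGraph box_adj_sym box_adj_irr.

End CartesianProduct.

Section Path.
Variable n : nat.

Definition path_adj : rel 'I_n := fun i j => (i.+1 == j) || (j.+1 == i).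

Lemma path_adj_sym : symmetric path_adj.
Proof. by move=> i j; rewrite /path_adj orbC. Qed.

Lemma path_adj_irr : irreflexive path_adj.
Proof. by move=> i; rewrite /path_adj orbb -[X in _ == X]addn0 -addn1 eqn_add2l. Qed.

Definition path_graph : sgraph := SGraph path_adj_sym path_adj_irr.

End Path.

(* Main.v *)
Require Import Defs.
From mathcomp Require Import all_boot all_order all_algebra.
From mathcomp Require Import zify.

(* Let D be a minimum dominating set of X [] Y [] Z, S one of X, and attach every
   vertex of X to an element of S dominating it.  A cell (i, y, z) consists of the
   points (x, y, z) with x attached to i; it is occupied if it meets D, and far if
   no cell (i, y', z) with y' in N[y] is occupied.  For fixed i and z, the occupied
   and the far y's together dominate Y (Clark and Suen).  The points of a far cell
   can only be dominated along X or along Z, so for every y and every set C of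
   layers, the i having a far cell in a layer of C all of whose occupied
   Z-neighbours also lie in C are dominated by the points of D over y and C:
   there are at most as many of them as such points.  If, for all disjoint U and E
   in Z, a weighted family of sets C turns these bounds into
   b * #far <= a * #occupied, then b * |Z| * gamma(X) * gamma(Y) <= (a + b) * |D|.
   On a path, all singletons and all pairs of consecutive layers give b = 2, a = 5;
   together with gamma(P_n) <= ceil(n / 3) this suffices unless n is 1, 2, 4 or 7,
   and for these n there are better explicit families. *)

Set Implicit Arguments.
Unset Strict Implicit.
Unset Printing Implicit Defensive.

(** * Certificates for an arbitrary third factor *)

Definition captures (Z : sgraph) (U E C : {set Z}) : bool :=
  [exists z in U :&: C, [forall z' in E, adj z z' ==> (z' \in C)]].

(* [U] and [E] stand for the far and the occupied layers of some fixed i and y. *)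
Definition certificate (Z : sgraph) (Cs : seq {set Z}) (a b : nat) : Prop :=
  forall U E : {set Z}, [disjoint U & E] ->
    b * #|U| + \sum_(C <- Cs) #|E :&: C|
      <= \sum_(C <- Cs) captures U E C + a * #|E|.

Lemma leq_domination_number (G : sgraph) (S : {set G}) :
  dominating S -> domination_number G <= #|S|.
Proof. by case: (domination_numberP G) => _; apply. Qed.

Lemma sum_nat_of_bool (T : finType) (P Q : pred T) :
  \sum_(i | P i) Q i = #|[set i | P i && Q i]|.
Proof.
rewrite -sum1dep_card big_mkcondr; apply: eq_bigr => i _.
by case: (Q i).
Qed.

(** * Counting occupied and far cells in a product of three graphs *)

Section ThreeFold.

Variables (X Y Z : sgraph) (D : {set box (box X Y) Z}) (S : {set X}).
Hypotheses (domD : dominating D) (domS : dominating S).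
Hypothesis minS : #|S| = domination_number X.

Definition rep (x : X) : X :=
  if x \in S then x else odflt x [pick u in S | adj x u].

Lemma rep_in x : rep x \in S.
Proof.
rewrite /rep; case: ifP => // xS; case: pickP => [u /andP[]//|no].
move/forallP/(_ x): domS; rewrite xS => /exists_inP[u uS axu].
by have:= no u; rewrite /= uS axu.
Qed.

Lemma repP x : (rep x == x) || adj x (rep x).
Proof.
rewrite /rep; case: ifP => [|_]; first by rewrite eqxx.
by case: pickP => [u /andP[_ ->]|_]; rewrite ?orbT ?eqxx.
Qed.

Definition occ (i : X) (y : Y) : {set Z} :=
  [set z | [exists x, (rep x == i) && (((x, y), z) \in D)]].

Definition far (i : X) (y : Y) : {set Z} :=
  [set z | [forall y', ((y' == y) || adj y y') ==> (z \notin occ i y')]].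

Lemma far_occ_disjoint i y : [disjoint far i y & occ i y].
Proof.
rewrite disjoint_subset; apply/subsetP => z; rewrite inE => /forallP/(_ y).
by rewrite eqxx.
Qed.

(** A [y] that is not far has, by definition, an occupied cell over its closed neighbourhood. *)
Lemma occ_far_dominates i z :
  domination_number Y <= #|[set y | z \in occ i y]| + #|[set y | z \in far i y]|.
Proof.
set A := [set y | _]; set B := [set y | _].
have [leU _] := leq_card_setU A B; apply: leq_trans leU; apply: leq_domination_number.
apply/forallP => y; rewrite in_setU.
have [yB|yB] := boolP (y \in B); first by rewrite orbT.
rewrite orbF.
have : z \notin far i y by move: yB; rewrite inE.
rewrite inE => /forallPn[y']; rewrite negb_imply negbK => /andP[yy' zy'].
have y'A : y' \in A by rewrite inE.
case/orP: yy' => [/eqP <-|ayy']; first by rewrite y'A.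
by apply/orP; right; apply/exists_inP; exists y'; rewrite // in_setU y'A.
Qed.

Definition layer (y : Y) (z : Z) : {set box (box X Y) Z} :=
  [set p in D | (p.1.2 == y) && (p.2 == z)].

(** Exchange argument: replacing the captured elements of [S] by the first coordinates of the points
    of [D] over [y] and [C] yields another dominating set of [X], so minimality of [S] gives the
    bound. *)
Lemma captured_cells y (C : {set Z}) :
  \sum_(i in S) captures (far i y) (occ i y) C <= \sum_(z in C) #|layer y z|.
Proof.
pose T1 : {set X} := [set x | [exists z in C, ((x, y), z) \in D]].
pose T2 : {set X} := [set i in S | ~~ captures (far i y) (occ i y) C].
have domT : dominating (T1 :|: T2).
  apply/forallP => x; rewrite in_setU.
  have [cap|ncap] := boolP (captures (far (rep x) y) (occ (rep x) y) C); last first.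
    have rT : rep x \in T2 by rewrite inE rep_in.
    case/orP: (repP x) => [/eqP <-|axr]; first by rewrite rT !orbT.
    by apply/orP; right; apply/exists_inP; exists (rep x); rewrite // in_setU rT orbT.
  have occI x' y' z' : rep x' = rep x -> ((x', y'), z') \in D -> z' \in occ (rep x) y'.
    by move=> rr xD; rewrite inE; apply/existsP; exists x'; rewrite rr eqxx.
  case/exists_inP: cap => z; rewrite inE => /andP[].
  rewrite inE => /forallP zfar zC /forall_inP zC'.
  (* A dominator equal to the point or adjacent along [Y] would contradict farness; one adjacent
     along [Z] lies in an occupied layer, hence over [C]; one adjacent along [X] stays in layer [z],
     which is in [C]. *)
  have /orP[vD|/exists_inP[[[x' y'] z'] qD]] := forallP domD ((x, y), z).
    by have:= zfar y; rewrite eqxx (occI _ _ _ _ vD).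
  case/orP => /andP[/= /eqP e1].
    case: e1 => ? ?; subst x' y' => azz'.
    have z'o := occI x y z' erefl qD.
    have z'C : z' \in C by have:= zC' _ z'o; rewrite azz'.
    by rewrite inE; apply/orP; left; apply/orP; left; apply/exists_inP; exists z'.
  subst z'; case/orP => /andP[/= /eqP e1 axx]; last first.
    apply/orP; right; apply/exists_inP; exists x' => //.
    rewrite in_setU; apply/orP; left; rewrite inE; apply/exists_inP; exists z => //.
    by rewrite e1.
  by subst x'; have:= zfar y'; rewrite axx orbT (occI _ _ _ _ qD).
have cT1 : #|T1| <= \sum_(z in C) #|layer y z|.
  have sub : T1 \subset [set p.1.1 | p in \bigcup_(z in C) layer y z].
    apply/subsetP => x; rewrite inE => /exists_inP[z zC xD].
    apply/imsetP; exists ((x, y), z) => //; apply/bigcupP; exists z => //.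
    by rewrite inE xD !eqxx.
  apply: leq_trans (subset_leq_card sub) _; apply: leq_trans (leq_imset_card _ _) _.
  apply: (big_rec2 (fun (A : {set _}) m => #|A| <= m)); first by rewrite cards0.
  move=> z A m _ le; apply: leq_trans (leq_card_setU _ _).1 _.
  exact: leq_add.
have splitS : \sum_(i in S) captures (far i y) (occ i y) C + #|T2| = #|S|.
  rewrite -sum1dep_card big_mkcondr -big_split -[RHS]sum1_card /=.
  by apply: eq_bigr => i _; case: captures.
have := leq_domination_number domT.
have := (leq_card_setU T1 T2).1.
lia.
Qed.

Lemma occ_le_layer y z : \sum_(i in S) (z \in occ i y) <= #|layer y z|.
Proof.
rewrite sum_nat_of_bool.
apply: leq_trans (leq_imset_card (fun p : box (box X Y) Z => rep p.1.1) (layer y z)).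
apply: subset_leq_card; apply/subsetP => i; rewrite !inE.
case/andP=> _ /existsP[x /andP[/eqP <- xD]].
by apply/imsetP; exists ((x, y), z); rewrite // inE xD !eqxx.
Qed.

Lemma card_layers : #|D| = \sum_y \sum_z #|layer y z|.
Proof.
rewrite -sum1_card (partition_big (fun p : box (box X Y) Z => p.1.2) predT) //=.
apply: eq_bigr => y _; rewrite (partition_big (fun p : box (box X Y) Z => p.2) predT) //=.
apply: eq_bigr => z _; rewrite -sum1_card; apply: eq_bigl => p.
by rewrite inE andbA.
Qed.

(** Summing over all [i] in [S] and all [y] bounds [b] times the number of far cells by [a * #|D|];
    the occupied cells number at most [#|D|]. *)
Lemma certificate_bound (Cs : seq {set Z}) a b : certificate Cs a b ->
  b * (#|Z| * (domination_number X * domination_number Y)) <= (a + b) * #|D|.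
Proof.
move=> cert.
pose cov z := \sum_(C <- Cs) (z \in C).
pose e y z := \sum_(i in S) (z \in occ i y).
(* Take [U] empty and [E] a single layer in the certificate: nothing is captured, so no layer is
   covered more than [a] times. *)
have cov_le z : cov z <= a.
  have /cert : [disjoint set0 & [set z]] by rewrite -setI_eq0 set0I.
  rewrite cards0 muln0 cards1 muln1.
  rewrite [\sum_(C <- Cs) captures _ _ _]big1 => [|C _]; last first.
    by case: (boolP (captures _ _ _)) => // /exists_inP[z']; rewrite set0I inE.
  congr (_ <= a); apply: eq_bigr => C _; have [zC|zC] := boolP (z \in C).
    by rewrite (setIidPl _) ?sub1set // cards1.
  by apply/eqP; rewrite cards_eq0 setI_eq0 disjoints1.
have sum_cov (F : Z -> nat) : \sum_(C <- Cs) \sum_(z in C) F z = \sum_z cov z * F z.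
  under eq_bigr => C _ do rewrite big_mkcond.
  rewrite exchange_big; apply: eq_bigr => z _; rewrite /cov big_distrl /=.
  by apply: eq_bigr => C _; case: (z \in C); rewrite ?mul1n.
have Etot : \sum_(i in S) \sum_y #|occ i y| = \sum_y \sum_z e y z.
  rewrite exchange_big; apply: eq_bigr => y _; rewrite exchange_big /=.
  by apply: eq_bigr => i _; rewrite sum_nat_of_bool; apply: eq_card => z; rewrite inE.
have Wtot : \sum_(i in S) \sum_y \sum_(C <- Cs) #|occ i y :&: C|
    = \sum_y \sum_z cov z * e y z.
  rewrite exchange_big; apply: eq_bigr => y _; rewrite exchange_big -sum_cov.
  apply: eq_bigr => C _; rewrite exchange_big; apply: eq_bigr => i _.
  by rewrite sum_nat_of_bool; apply: eq_card => z; rewrite !inE andbC.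
have A1 : #|Z| * (#|S| * domination_number Y)
    <= \sum_(i in S) \sum_y #|occ i y| + \sum_(i in S) \sum_y #|far i y|.
  rewrite mulnC -mulnA (mulnC (domination_number Y)) -sum_nat_const -big_split /=.
  apply: leq_sum => i _; rewrite -sum_nat_const.
  apply: leq_trans (leq_sum _ (fun z _ => occ_far_dominates i z)) _.
  rewrite big_split /=; apply: eq_leq.
  congr (_ + _); under eq_bigr => z _ do rewrite -sum1dep_card big_mkcond;
    by rewrite exchange_big; apply: eq_bigr => y _; rewrite -big_mkcond sum1_card.
have A2 : b * (\sum_(i in S) \sum_y #|far i y|) + \sum_y \sum_z cov z * e y z
    <= \sum_y \sum_z cov z * #|layer y z| + a * (\sum_y \sum_z e y z).
  rewrite -Etot -Wtot !big_distrr -big_split /=.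
  apply: (@leq_trans (\sum_(i in S) \sum_y
      (\sum_(C <- Cs) captures (far i y) (occ i y) C + a * #|occ i y|))).
    apply: leq_sum => i _; rewrite big_distrr -big_split; apply: leq_sum => y _.
    exact/cert/far_occ_disjoint.
  under eq_bigr => i _ do rewrite big_split -big_distrr /=.
  rewrite big_split leq_add2r exchange_big; apply: leq_sum => y _.
  rewrite exchange_big -sum_cov; apply: leq_sum => C _; exact: captured_cells.
(* For each [y] and [z], the excess of points of [D] over occupied cells is nonnegative and has
   weight [cov z], at most [a]. *)
have A3 : \sum_y \sum_z cov z * #|layer y z| + a * (\sum_y \sum_z e y z)
    <= a * #|D| + \sum_y \sum_z cov z * e y z.
  rewrite card_layers !big_distrr -!big_split; apply: leq_sum => y _.
  rewrite !big_distrr -!big_split; apply: leq_sum => z _ /=.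
  have := cov_le z; have := occ_le_layer y z; rewrite -/(e y z).
  move=> /subnKC <- /subnKC <-; rewrite !(mulnDl, mulnDr); lia.
have A4 : \sum_y \sum_z e y z <= #|D|.
  rewrite card_layers; apply: leq_sum => y _; apply: leq_sum => z _.
  exact: occ_le_layer.
rewrite -minS; move: A1; rewrite Etot.
move: (\sum_(i in S) _) (\sum_y \sum_z e y z) A2 A3 A4 => U E A2 A3 A4 A1.
have := leq_mul (leqnn b) A1; have := leq_mul (leqnn b) A4; lia.
Qed.

End ThreeFold.

(** * Certificates on paths, phrased with Boolean words *)

(** The truncation [0.-1 = 0] does no harm, as words are false at [0]. *)
Definition word_captures (u e : nat -> bool) (C : seq nat) : bool :=
  has (fun z => [&& u z, e z.-1 ==> (z.-1 \in C) & e z.+1 ==> (z.+1 \in C)]) C.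

(* Layers of a path are numbered from 1, with empty layers 0 and > size s. *)
Definition word (s : bitseq) : nat -> bool := nth false (false :: s).

Definition word_certificate (us es : bitseq) (Cs : seq (seq nat)) (a b : nat) : bool :=
  b * count id us + sumn [seq count (word es) C | C <- Cs]
    <= count (word_captures (word us) (word es)) Cs + a * count id es.

Definition disjoint_words (us es : bitseq) : bool :=
  ~~ has (fun p => p.1 && p.2) (zip us es).

(** Entries [0] and above [n] drop out of the lists; the words are false there, so neither captures
    nor counts are affected. *)
Lemma path_certificate n (Cs : seq (seq nat)) a b :
    (forall us es : bitseq, size us = n -> size es = n -> disjoint_words us es ->
      word_certificate us es Cs a b) ->
  certificate [seq [set i : path_graph n | i.+1 \in C] | C <- Cs] a b.
Proof.
move=> wcert U E dUE.
pose bits (A : {set 'I_n}) := [seq i \in A | i <- enum 'I_n].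
have size_bits A : size (bits A) = n by rewrite size_map size_enum_ord.
have word_bits A z : word (bits A) z -> exists2 i : 'I_n, z = i.+1 & i \in A.
  case: z => [//|z]; rewrite /word /=; have [zn|nz] := ltnP z n; last first.
    by rewrite nth_default // size_bits.
  rewrite (nth_map (Ordinal zn)) ?size_enum_ord // => h; exists (Ordinal zn) => //.
  by rewrite -[X in X \in _](nth_ord_enum (Ordinal zn)).
have bits_word A (i : 'I_n) : word (bits A) i.+1 = (i \in A).
  by rewrite /word /= (nth_map i) ?size_enum_ord // nth_ord_enum.
have count_bits A : count id (bits A) = #|A|.
  by rewrite count_map -size_filter cardE enumT.
have dis : disjoint_words (bits U) (bits E).
  rewrite /disjoint_words /bits zip_map has_map; apply/hasPn => i _ /=.
  by have := disjointFr dUE (x := i); case: (i \in U) => // ->.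
have := wcert _ _ (size_bits U) (size_bits E) dis.
rewrite /word_certificate !count_bits => wc.
apply: leq_trans (leq_trans wc _).
  rewrite leq_add2l big_map sumnE big_map; apply: leq_sum => C _.
  rewrite -size_filter cardE -(size_map (fun i : 'I_n => i.+1)).
  apply: uniq_leq_size; first by rewrite map_inj_uniq ?enum_uniq // => i j [] /val_inj.
  move=> z /mapP[i]; rewrite mem_enum !inE => /andP[iE iC] ->.
  by rewrite mem_filter bits_word iE.
rewrite leq_add2r big_map -sum1_count big_mkcond; apply: leq_sum => C _.
case: ifP => // /hasP[z zC /and3P[/word_bits[i zi iU] el er]].
rewrite lt0b; apply/exists_inP; exists i; first by rewrite !inE iU -zi.
apply/forall_inP => j jE; apply/implyP => /orP[]/eqP ij; rewrite inE.
  by move: er; rewrite zi ij bits_word jE.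
by move: el; rewrite zi /= -ij bits_word jE.
Qed.

(** * All paths: domination number and a uniform certificate *)

(** An upper bound suffices, as the domination number of the path stands on the smaller side of the
    theorem. *)
Lemma path_domination_number n m :
  0 < n -> n <= 3 * m -> domination_number (path_graph n) <= m.
Proof.
case: n => // n _ le_n.
(* Centres of consecutive triples; [n] is now the last vertex, and [minn] moves the centre of a last
   triple reduced to one vertex back onto the path. *)
pose T := [set (inord (minn (3 * j + 1) n) : path_graph n.+1) | j : 'I_m].
suff domT : dominating T.
  apply: leq_trans (leq_domination_number domT) _.
  by rewrite -[X in _ <= X]card_ord leq_imset_card.
apply/forallP => v; have vn : v < n.+1 := ltn_ord v.
have jm : v %/ 3 < m by lia.
pose u : path_graph n.+1 := inord (minn (3 * (v %/ 3) + 1) n).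
have uT : u \in T by apply/imsetP; exists (Ordinal jm).
have uE : val u = minn (3 * (v %/ 3) + 1) n by rewrite /u /= inordK //; lia.
have [->|ne] := eqVneq v u; first by rewrite uT.
apply/orP; right; apply/exists_inP; exists u => //=.
have : val v != minn (3 * (v %/ 3) + 1) n by rewrite -uE.
by rewrite /path_adj; move: uE => /= ->; lia.
Qed.

Lemma path_bound (X Y : sgraph) n (Cs : seq (seq nat)) a b :
    (forall us es : bitseq, size us = n -> size es = n -> disjoint_words us es ->
      word_certificate us es Cs a b) ->
  b * (n * (domination_number X * domination_number Y))
    <= (a + b) * domination_number (box (box X Y) (path_graph n)).
Proof.
move=> /path_certificate cert.
have [[D domD <-] _] := domination_numberP (box (box X Y) (path_graph n)).
have [[S domS minS] _] := domination_numberP X.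
by have := certificate_bound domD domS minS cert; rewrite card_ord.
Qed.

(* The pairs {0, 1} and {n, n + 1} stick out of the path: they add {1} and {n}. *)
Definition singles_and_pairs n : seq (seq nat) :=
  [seq [:: j.+1] | j <- iota 0 n] ++ [seq [:: j; j.+1] | j <- iota 0 n.+1].

(** A discharging argument. The constant 5 is 3 + 2: a layer lies in one singleton and two pairs,
    and an occupied layer gives 1 to each of its at most two neighbours. *)
Lemma singles_and_pairs_certificate n (us es : bitseq) :
  size us = n -> size es = n -> disjoint_words us es ->
  word_certificate us es (singles_and_pairs n) 5 2.
Proof.
move=> su se dis; pose u := word us; pose e := word es.
have count_word s : size s = n -> count id s = \sum_(i < n) word s i.+1.
  move=> ss; rewrite -sumn_count sumnE big_map (big_nth false) ss big_mkord.
  by apply: eq_bigr.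
have disj z : ~~ (u z && e z).
  case: z => [//|z]; apply/negP => /andP[uz ez].
  have zu : z < size us.
    by rewrite ltnNge; apply/negP => us_z; move: uz; rewrite /u /word /= nth_default.
  move/negP: dis; apply; apply/hasP; exists (nth (false, false) (zip us es) z).
    by apply: mem_nth; rewrite size_zip su se minnn -su.
  by rewrite nth_zip ?su ?se //=; apply/andP.
have last0 s : size s = n -> word s n.+1 = false.
  by move=> ss; rewrite /word /= nth_default ?ss.
(* Every z in u must receive 2: 1 from {z} if it is captured, 1 from each neighbour
   in e, alpha z / 2 from {z, z + 1} and beta z / 2 from {z - 1, z}; a captured pair
   is shared equally when both its elements are in u. *)
pose alpha z : nat := (u z && ~~ e z.-1) + [&& u z, ~~ e z.-1 & ~~ u z.+1].
pose beta z : nat := (u z && ~~ e z.+1) + [&& u z, ~~ e z.+1 & ~~ u z.-1].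
(* Boundary terms vanish, so a sum over layers is also a sum over pairs, indexed by their lower
   ([shift0]) or upper ([shiftn]) element. *)
have shift0 (h : nat -> nat) : h 0 = 0 -> \sum_(i < n) h i.+1 = \sum_(j < n.+1) h j.
  by move=> h0; rewrite big_ord_recl h0 add0n.
have shiftn (h : nat -> nat) : h n.+1 = 0 -> \sum_(i < n) h i.+1 = \sum_(j < n.+1) h j.+1.
  by move=> hn; rewrite big_ord_recr /= hn addn0.
have iotaE m (h : nat -> nat) : \sum_(j <- iota 0 m) h j = \sum_(j < m) h j.
  by rewrite -(big_mkord predT h) /index_iota subn0.
rewrite /word_certificate !count_word // /singles_and_pairs.
rewrite map_cat sumn_cat count_cat !count_map.
rewrite -!sumn_count -!map_comp !sumnE !big_map !iotaE -/u -/e.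
set Su := \sum_(i < n) _; set Se := \sum_(i < n) nat_of_bool (e _).
have sum_e : \sum_(j < n.+1) e j = Se by rewrite -(shift0 (fun j => e j : nat)).
have sum_eS : \sum_(j < n.+1) e j.+1 = Se.
  by rewrite -(shiftn (fun j => e j : nat)) // /e last0.
have -> : \sum_(j < n) (count e \o (fun j => [:: j.+1])) j = Se.
  by apply: eq_bigr => j _ /=; rewrite addn0.
have -> : \sum_(j < n.+1) (count e \o (fun j => [:: j; j.+1])) j = Se + Se.
  under eq_bigr => j _ do rewrite /= addn0.
  by rewrite big_split sum_e sum_eS.
set s := \sum_(j < n) _; set p := \sum_(j < n.+1) _.
have pairs : \sum_(i < n) alpha i.+1 + \sum_(i < n) beta i.+1 <= 2 * p.
  rewrite (shift0 alpha) // (shiftn beta); last by rewrite /beta /u last0.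
  rewrite -big_split big_distrr; apply: leq_sum => j _ /=.
  have capl : u j && ~~ e j.-1 -> word_captures u e [:: val j; j.+1].
    move=> /andP[uj /negbTE ej]; apply/hasP; exists (val j); first exact: mem_head.
    by rewrite uj ej !inE eqxx orbT implybT.
  have capr : u j.+1 && ~~ e j.+2 -> word_captures u e [:: val j; j.+1].
    move=> /andP[uj /negbTE ej]; apply/hasP; exists j.+1; first by rewrite !inE eqxx orbT.
    by rewrite uj ej !inE eqxx implybT.
  move: capl capr; rewrite /alpha /beta /=.
  case: (word_captures _ _ _) => [_ _|capl capr].
    by case: (u j) (u j.+1) (e j.-1) (e j.+2) => [] [] [] [].
  case: (u j) (u j.+1) (e j.-1) (e j.+2) capl capr => [] [] [] [] //= capl capr;
    by [have := capl isT | have := capr isT].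
(* Counted in half units. If just one neighbour of a layer of [u] is in [e], that neighbour is not
   in [u], so the pair formed with it is not shared. *)
have local : 4 * Su <= 2 * s + (\sum_(i < n) alpha i.+1 + \sum_(i < n) beta i.+1)
    + 2 * (\sum_(i < n) (u i.+1 && e i) + \sum_(i < n) (u i.+1 && e i.+2)).
  rewrite !big_distrr -!big_split big_distrr -!big_split; apply: leq_sum => i _ /=.
  have cap : [&& u i.+1, ~~ e i & ~~ e i.+2] -> word_captures u e [:: i.+1].
    by move=> /and3P[ui /negbTE ei /negbTE eii]; rewrite /word_captures /= ui ei eii.
  have := disj i; have := disj i.+2; move: cap; rewrite /alpha /beta /=.
  case: (word_captures _ _ _) => [_|cap].
    by case: (u i.+1) (e i) (e i.+2) (u i) (u i.+2) => [] [] [] [] [].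
  case: (u i.+1) (e i) (e i.+2) (u i) (u i.+2) cap => [] [] [] [] [] //= cap;
    by have := cap isT.
have eL : \sum_(i < n) (u i.+1 && e i) <= Se.
  rewrite -sum_e big_ord_recr /=; apply: leq_trans (leq_addr _ _).
  by apply: leq_sum => i _; case: (u _).
have eR : \sum_(i < n) (u i.+1 && e i.+2) <= Se.
  rewrite -sum_eS big_ord_recl /= /bump; apply: leq_trans (leq_addl _ _).
  by apply: leq_sum => i _; case: (u _).
lia.
Qed.

(** * Small paths, by exhaustive check *)

Fixpoint bitseqs n : seq bitseq :=
  if n is n'.+1 then map (cons true) (bitseqs n') ++ map (cons false) (bitseqs n')
  else [:: [::]].

Lemma mem_bitseqs s : s \in bitseqs (size s).
Proof.
by elim: s => //= -[] s IHs; rewrite mem_cat map_f ?orbT.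
Qed.

Lemma word_certificate_check n Cs a b :
    all (fun us => all (fun es => disjoint_words us es ==>
      word_certificate us es Cs a b) (bitseqs n)) (bitseqs n) ->
  forall us es : bitseq, size us = n -> size es = n -> disjoint_words us es ->
    word_certificate us es Cs a b.
Proof.
move=> ok us es su se; apply/implyP; move: ok.
move=> /allP/(_ us); rewrite -{1}su mem_bitseqs => /(_ isT)/allP/(_ es).
by rewrite -{1}se mem_bitseqs; apply.
Qed.

(** Here and for [n] = 2, 4, 7 the ratio [b / (a + b)] is exactly the one required: (k + 1) / (4k +
    2) if n = 3k + 1, and (k + 1) / (4k + 3) if n = 3k + 2. *)
Lemma path1_certificate us es : size us = 1 -> size es = 1 -> disjoint_words us es ->
  word_certificate us es [:: [:: 1]] 1 1.
Proof. by apply: word_certificate_check; vm_compute. Qed.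

Lemma path2_certificate us es : size us = 2 -> size es = 2 -> disjoint_words us es ->
  word_certificate us es [:: [:: 1; 2]; [:: 1; 2]] 2 1.
Proof. by apply: word_certificate_check; vm_compute. Qed.

Lemma path4_certificate us es : size us = 4 -> size es = 4 -> disjoint_words us es ->
  word_certificate us es [:: [:: 1]; [:: 1; 2]; [:: 3; 4]; [:: 4]] 2 1.
Proof. by apply: word_certificate_check; vm_compute. Qed.

(* The multiplicities were found by linear programming. *)
Definition path7_sets : seq (seq nat) :=
  nseq 3 [:: 1] ++ [:: [:: 2]; [:: 4]; [:: 5]] ++ nseq 3 [:: 7]
  ++ nseq 2 [:: 1; 2] ++ nseq 3 [:: 2; 3] ++ nseq 3 [:: 4; 5] ++ [:: [:: 5; 6]]
  ++ nseq 3 [:: 6; 7].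

Lemma path7_certificate us es : size us = 7 -> size es = 7 -> disjoint_words us es ->
  word_certificate us es path7_sets 7 3.
Proof. by apply: word_certificate_check; vm_compute. Qed.

(** * The three inequalities over the rationals *)

Import Order.TTheory GRing.Theory Num.Theory.
Local Open Scope ring_scope.

Lemma ler_ratio (p q g x y d : nat) : (0 < q)%N -> (p * (g * (x * y)) <= q * d)%N ->
  p%:R / q%:R * g%:R * x%:R * y%:R <= d%:R :> rat.
Proof.
move=> q0 le; have q0' : 0 < q%:R :> rat by rewrite ltr0n.
rewrite -!mulrA mulrCA ler_pdivrMl // -!natrM ler_nat; lia.
Qed.

Theorem theorem3 (X Y : sgraph) (k n : nat) :
  [/\ n = (3 * k)%N -> (1 <= k)%N ->
        (domination_number (box (box X Y) (path_graph n)))%:R >=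
        3 / 4 * (domination_number (path_graph n))%:R
          * (domination_number X)%:R * (domination_number Y)%:R :> rat,
      n = (3 * k + 1)%N ->
        (domination_number (box (box X Y) (path_graph n)))%:R >=
        (3 * k + 1)%:R / (4 * k + 2)%:R * (domination_number (path_graph n))%:R
          * (domination_number X)%:R * (domination_number Y)%:R :> rat
    & n = (3 * k + 2)%N ->
        (domination_number (box (box X Y) (path_graph n)))%:R >=
        (3 * k + 2)%:R / (4 * k + 3)%:R * (domination_number (path_graph n))%:R
          * (domination_number X)%:R * (domination_number Y)%:R :> rat].
Proof.
have general := path_bound X Y (@singles_and_pairs_certificate n).
have from_path m (p q : nat) : (0 < n)%N -> (n <= 3 * m)%N -> (0 < q)%N ->
    (p * (m * (domination_number X * domination_number Y))
      <= q * domination_number (box (box X Y) (path_graph n)))%N ->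
    p%:R / q%:R * (domination_number (path_graph n))%:R
      * (domination_number X)%:R * (domination_number Y)%:R
      <= (domination_number (box (box X Y) (path_graph n)))%:R :> rat.
  move=> n0 nm q0 le; apply: ler_ratio => //; apply: leq_trans le.
  by rewrite leq_mul2l leq_mul2r path_domination_number ?orbT.
have small m Cs a b : n = m -> (forall us es : bitseq, size us = m -> size es = m ->
    disjoint_words us es -> word_certificate us es Cs a b) ->
    (b * (m * (domination_number X * domination_number Y))
      <= (a + b) * domination_number (box (box X Y) (path_graph n)))%N.
  by move=> ->; exact: path_bound.
have path1 n1 := small 1%N _ _ _ n1 path1_certificate.
have path2 n2 := small 2%N _ _ _ n2 path2_certificate.
have path4 n4 := small 4%N _ _ _ n4 path4_certificate.
have path7 n7 := small 7%N _ _ _ n7 path7_certificate.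
move: (domination_number (box _ _)) (domination_number X * domination_number Y)%N
  general path1 path2 path4 path7 from_path => d w general path1 path2 path4 path7 from_path.
split=> [def_n k1|def_n|def_n].
- apply: (from_path k); nia.
- apply: (from_path k.+1); try lia.
  (* The uniform ratio 2 / 7 is enough when 7 (k + 1) <= 2 (4k + 2), that is k >= 3; this leaves [n]
     = 1, 4, 7. *)
  have [k3|k3] := leqP 3 k; first by nia.
  by case: k k3 def_n => [|[|[|//]]] _ def_n; lia.
- apply: (from_path k.+1); try lia.
  (* Now 7 (k + 1) <= 2 (4k + 3) is needed, that is k >= 1; this leaves [n] = 2. *)
  case: k def_n => [|k] def_n; first by lia.
  nia.
Qed.
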